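(* Let $(G,+)$ be a group (not necessarily abelian, written additively with identity $0$) and let $A\subseteq G\setminus\{0\}$ be a finite subset with $|A|\leq 5$. Then there exists an ordering $(a_1,\ldots,a_k)$ of the elements of $A$ (where $k=|A|$) whose partial sums $s_j=a_1+a_2+\cdots+a_j$, $1\leq j\leq k$, are pairwise distinct.
   Context: Partial sums are taken in the given order: $s_j=a_1+\cdots+a_j$ (left to right), since the group may be nonabelian. *)

(* Defs.v *)
From mathcomp Require Export all_boot finmap.

Set Implicit Arguments.
Unset Strict Implicit.
Unset Printing Implicit Defensive.

(* MathComp's additive structures are commutative, so a possibly nonabelian
   group is a groupType, written multiplicatively: (+, 0) becomes ( *, 1).
   For s = [:: a_1; ...; a_k] the result is [:: s_1; ...; s_k] with
   s_j = a_1 * ... * a_j bracketed from the left; the empty product is not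
   listed. *)
Definition partial_sums (G : groupType) (s : seq G) : seq G :=
  scanl (fun x y => x * y)%g 1%g s.

(* Main.v *)
(* Partial sums s_i and s_j coincide iff the block a_(i+1) ... a_j is trivial, so
   an ordering works iff no block of length at least 2 that avoids the first
   term is trivial. For five elements, split on the number of pairs {p, p^-1}
   of distinct inverse elements.
   - No pair: if every ordering a b c d e fails, then the inverse of each
     product cd lies in {a, b, e}; if it is a, then be = a, and applying this
     to be gives a^2 = 1, so cd = a. Applying it again to bc is contradictory.
   - One pair p, q and x, y, z: failure of x p y z q (for all permutations of
     x, y, z) forces yz into {p, q}, so that multiplication is as in S_3, and
     p q x z y works.
   - Two pairs and x: failure of x p q p^-1 q^-1 makes p and q commute;
     failure of p q p^-1 q^-1 x and of its variant under p <-> p^-1 gives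
     x = qp = qp^-1. *)
From mathcomp Require Import zify.
Require Import Defs.

Local Open Scope group_scope.

(** * Orderings and trivial blocks *)

(** The partial sums of [a :: s] are the left translates by [a] of [1] and of the partial sums of
    [s], and translation is injective. *)
Lemma uniq_partial_sums_cons {G : groupType} (a : G) (s : seq G) :
  uniq (partial_sums (a :: s)) = (1 \notin partial_sums s) && uniq (partial_sums s).
Proof.
have scanlM x t : scanl *%g x t = [seq x * y | y <- partial_sums t] :> seq G.
  rewrite /partial_sums -{1}[x]mulg1; elim: t 1 => //= b t IHt y.
  by rewrite -mulgA IHt.
rewrite {1}/partial_sums /= mul1g scanlM (map_inj_uniq (mulgI a)).
by rewrite -{1}[a]mulg1 (mem_map (mulgI a)).
Qed.

(** Searching the finite list of permutations makes this a boolean, so arguments by contradiction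
    stay constructive. *)
Definition sequenceable {G : groupType} (s : seq G) :=
  has (fun t => uniq (partial_sums t)) (permutations s).

Lemma sequenceableP {G : groupType} (s : seq G) :
  reflect (exists2 t, perm_eq t s & uniq (partial_sums t)) (sequenceable s).
Proof.
by apply: (iffP hasP) => -[t ts tu]; exists t; rewrite ?mem_permutations // in ts *.
Qed.

Lemma sequenceable_perm {G : groupType} (s t : seq G) :
  perm_eq s t -> sequenceable s -> sequenceable t.
Proof.
by move=> st /sequenceableP[r rs ru]; apply/sequenceableP; exists r => //;
  exact: perm_trans rs st.
Qed.

Lemma mulg1C {G : groupType} (x y : G) : x * y = 1 -> y * x = 1.
Proof. by move=> /mulg1_eq <-; rewrite mulVg. Qed.

Lemma mulg1_rot3 {G : groupType} (x y z : G) : x * y * z = 1 -> z * x * y = 1.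
Proof. by move/mulg1C; rewrite mulgA. Qed.

Lemma not_sequenceable5 {G : groupType} (s : seq G) (a b c d e : G) :
    ~~ sequenceable s -> 1 \notin s -> perm_eq [:: a; b; c; d; e] s ->
  [\/ [\/ b * c = 1, c * d = 1 | d * e = 1], b * c * d = 1, c * d * e = 1
    | b * c * d * e = 1].
Proof.
move=> /sequenceableP bad s1 ps.
have: ~~ uniq (partial_sums [:: a; b; c; d; e]).
  by apply/negP => u; apply: bad; exists [:: a; b; c; d; e].
move: s1; rewrite -(perm_mem ps) !uniq_partial_sums_cons /partial_sums /= !mul1g.
rewrite !inE !(eq_sym 1) !negb_or => /and5P[_ /negPf-> /negPf-> /negPf-> /negPf->].
rewrite /= !andbT !negb_and !negbK.
case/orP=> [/or3P[]|/orP[/orP[]|]] /eqP E.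
- by apply: Or41; apply: Or31.
- exact: Or42.
- exact: Or44.
- by apply: Or41; apply: Or32.
- exact: Or43.
- by apply: Or41; apply: Or33.
Qed.

(** * Five elements, by number of inverse pairs *)

(** Counting under an arbitrary predicate turns equality up to permutation into linear
    arithmetic. *)
Local Ltac perm_from H :=
  by apply: perm_trans H; clear; apply/permP => P /=; rewrite !addn0; lia.

Lemma sequenceable5_no_inverse {G : groupType} (s : seq G) :
    uniq s -> 1 \notin s -> size s = 5 ->
    {in s &, forall x y, x * y = 1 -> x = y} ->
  sequenceable s.
Proof.
move=> us s1 s5 noinv; apply/negPn/negP => bad.
pose arr a b c d e := perm_eq [:: a; b; c; d; e] s.
have neq a b c d e : arr a b c d e -> a <> b.
  by move=> h E; move: us; rewrite -(perm_uniq h) E /= inE eqxx.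
have mulN1 a b c d e : arr a b c d e -> a * b <> 1.
  move=> h E; apply: (neq _ _ _ _ _ h).
  by apply: noinv E; rewrite -(perm_mem h) !inE eqxx ?orbT.
have split5 a b c d e : arr a b c d e ->
    [\/ b * c * d = 1, c * d * e = 1 | b * c * d * e = 1].
  move=> h; case: (not_sequenceable5 _ _ _ _ _ _ bad s1 h) => [[]|||]; try by constructor.
  - by move/(mulN1 b c a d e); case; perm_from h.
  - by move/(mulN1 c d a b e); case; perm_from h.
  - by move/(mulN1 d e a b c); case; perm_from h.
(* If the inverse of [c * d] is none of [a], [b], [e], then the orders
   [a; b; c; d; e] and [b; a; c; d; e] can only fail through
   [b * c * d * e = 1] and [a * c * d * e = 1], so [a = b]. *)
have cover a b c d e : arr a b c d e -> [\/ a * c * d = 1, b * c * d = 1 | e * c * d = 1].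
  move=> h; have h' : arr b a c d e by perm_from h.
  case: (split5 _ _ _ _ _ h) => [?|/mulg1_rot3 ?|E]; try by constructor.
  case: (split5 _ _ _ _ _ h') => [?|/mulg1_rot3 ?|]; try by constructor.
  by rewrite -E => /mulIg/mulIg/mulIg/(neq _ _ _ _ _ h).
(* Since [b] and [e] differ from [a], neither is inverse to [c * d]; only the block [b * c * d * e]
   can be trivial. *)
have compl a b c d e : arr a b c d e -> a * c * d = 1 -> e * b = a.
  move=> h E; case: (split5 _ _ _ _ _ h) => [|/mulg1_rot3|/mulg1C].
  - by rewrite -E => /mulIg/mulIg/(neq b a c d e); case; perm_from h.
  - by rewrite -E => /mulIg/mulIg/(neq e a b c d); case; perm_from h.
  - by rewrite -E !mulgA => /mulIg/mulIg.
(* The inverse of [e * b = a] is [a], [c] or [d]; the last two are excluded by [mulN1]. *)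
have invol a b c d e : arr a b c d e -> a * c * d = 1 -> a * a = 1.
  move=> h E; have eb := compl _ _ _ _ _ h E.
  have h' : arr a c e b d by perm_from h.
  case: (cover _ _ _ _ _ h'); rewrite -mulgA eb //.
  - by move/(mulN1 c a b d e); case; perm_from h.
  - by move/(mulN1 d a b c e); case; perm_from h.
have no_triple a b c d e : arr a b c d e -> a * c * d <> 1.
  move=> h E; have aa := invol _ _ _ _ _ h E.
  have cd : c * d = a.
    by apply: (mulgI a); rewrite aa mulgA.
  have be : b * e = a by apply: (compl a e c d b) => //; perm_from h.
  have h' : arr a d b c e by perm_from h.
  (* Cases by the inverse of [b * c]: [a] gives [c = e], [d] gives [b * a = 1], [e] gives
     [c = a]. *)
  case: (cover _ _ _ _ _ h') => F.
  - have : b * c = b * e by apply: (mulgI a); rewrite be aa mulgA.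
    by move/mulgI/(neq c e a b d); case; perm_from h.
  - have dd : d * d = 1 by apply: (invol d a b c e) F; perm_from h.
    have : b * c = d by apply: (mulgI d); rewrite dd mulgA.
    move/(congr1 (fun x => x * d)); rewrite dd -mulgA cd.
    by move/(mulN1 b a c d e); case; perm_from h.
  - have bb : b * b = 1.
      apply: (invol b a c e d); first by perm_from h.
      by do 2!apply: mulg1_rot3.
    have ee : e * e = 1 by apply: (invol e a b c d) F; perm_from h.
    have : b * c = b * a.
      rewrite -be mulgA bb mul1g; apply: (mulgI e); by rewrite ee mulgA.
    by move/mulgI/(neq c a b d e); case; perm_from h.
case: s s5 @arr cover no_triple {us s1 noinv bad neq mulN1 split5 compl invol}
  => [|a [|b [|c [|d [|e []]]]]] //= _ cover no_triple.
case: (cover a b c d e (perm_refl _)); apply: no_triple.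
- exact: perm_refl.
- by apply: (_ : perm_eq [:: b; a; c; d; e] _); apply/permP => ? /=; lia.
- by apply: (_ : perm_eq [:: e; a; c; d; b] _); apply/permP => ? /=; lia.
Qed.

Lemma sequenceable5_one_inverse {G : groupType} (p q x y z : G) :
    uniq [:: p; q; x; y; z] -> 1 \notin [:: p; q; x; y; z] -> p * q = 1 ->
    x * y <> 1 -> x * z <> 1 -> y * z <> 1 ->
  sequenceable [:: p; q; x; y; z].
Proof.
set s := [:: p; q; x; y; z].
move=> us s1 pq xy xz yz; apply/negPn/negP => bad.
have neq a b c d e : perm_eq [:: a; b; c; d; e] s -> a <> b.
  by move=> h E; move: us; rewrite -(perm_uniq h) E /= inE eqxx.
have inv_uniq (a b c : G) : a * b = 1 -> a * c = 1 -> b = c by move=> /mulg1_eq <- /mulg1_eq.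
(* Read off the order [a; p; b; c; q]. *)
have prod_pq a b c : perm_eq [:: a; b; c] [:: x; y; z] -> b * c = p \/ b * c = q.
  move=> h; have h' : perm_eq [:: a; p; b; c; q] s.
    by move: h; clear => /permP h; apply/permP => P; move: (h P) => /=; rewrite !addn0; lia.
  have bc : b * c <> 1.
    have : [/\ b \in [:: x; y; z], c \in [:: x; y; z] & b <> c].
      rewrite -!(perm_mem h) !inE !eqxx !orbT; split=> //.
      by apply: (neq b c a p q); perm_from h'.
    rewrite !inE => -[/or3P[]/eqP-> /or3P[]/eqP->] // _;
      by move/mulg1C.
  case: (not_sequenceable5 _ _ _ _ _ _ bad s1 h') => [[]|||] //.
  - by move/(inv_uniq _ _ _ pq)/(neq q b a c p); case; perm_from h'.
  - by move/mulg1C/(inv_uniq _ _ _ (mulg1C _ _ pq))/(neq p c a b q); case; perm_from h'.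
  - rewrite -mulgA => /(inv_uniq _ _ _ pq); auto.
  - move/mulg1C/(inv_uniq _ _ _ (mulg1C _ _ pq)); auto.
  - by move/mulg1C; rewrite !mulgA (mulg1C _ _ pq) mul1g.
(* The products of two of x, y, z now behave as for the transpositions and
   3-cycles of S_3, where the order [p; q; x; z; y] works. *)
have key p' q' : perm_eq [:: p'; q'; x; y; z] s -> p' * q' = 1 ->
  (forall a b c, perm_eq [:: a; b; c] [:: x; y; z] -> b * c = p' \/ b * c = q') ->
  x * z <> q'.
  move=> h pq' prod exz.
  have qp' := mulg1C _ _ pq'.
  (* Were this product [q'], it would equal [x * z], and cancelling would give [y = x]; the next two
     products are settled likewise. *)
  have eyz : y * z = p'.
    case: (prod x y z (perm_refl _)) => //; rewrite -exz => /mulIg.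
    by move/(neq y x p' q' z); case; perm_from h.
  have exy : x * y = p'.
    case: (prod z x y) => //; first by clear; apply/permP => P /=; lia.
    by rewrite -exz => /mulgI/(neq y z p' q' x); case; perm_from h.
  have ezy : z * y = q'.
    case: (prod x z y) => //; first by clear; apply/permP => P /=; lia.
    by rewrite -exy => /mulIg/(neq z x p' q' y); case; perm_from h.
  have h' : perm_eq [:: p'; q'; x; z; y] s by perm_from h.
  have yp : q' * y <> 1.
    by move/(inv_uniq _ _ _ qp')/(neq p' y q' x z); case; perm_from h.
  have q1 : q' <> 1.
    by move=> E; move: s1; rewrite -(perm_mem h) !inE E eqxx !orbT.
  case: (not_sequenceable5 _ _ _ _ _ _ bad s1 h') => [[]|||].
  - by move/(inv_uniq _ _ _ qp')/(neq p' x q' y z); case; perm_from h.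
  - by rewrite exz.
  - by rewrite ezy.
  - rewrite -mulgA exz; move/(inv_uniq _ _ _ qp').
    by move/(neq p' q' x y z); case; perm_from h.
  - by rewrite exz.
  (* Here [y = p' * p'] commutes with [p' = y * z], hence with [z], which forces [p' = q']. *)
  - rewrite -(mulgA q') exz -mulgA => /(inv_uniq _ _ _ qp') E.
    have {}E : y = p' * p' by rewrite {2}E mulgA pq' mul1g.
    have : y * (y * z) = y * z * y by rewrite eyz E mulgA.
    rewrite -mulgA => /mulgI; rewrite eyz ezy.
    by move/(neq p' q' x y z); case; perm_from h.
(* The product [x * z] is [p] or [q]; [key] refutes both, by the symmetry between [p] and [q]. *)
case: (prod_pq y x z); first by clear; apply/permP => P /=; lia.
  apply: (key q p); [by clear; apply/permP => P /=; lia | exact: mulg1C |].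
  by move=> a b c /prod_pq []; auto.
exact: (key p q (perm_refl _) pq prod_pq).
Qed.

Lemma sequenceable5_two_inverses {G : groupType} (p q x : G) :
    uniq [:: p; p^-1; q; q^-1; x] -> 1 \notin [:: p; p^-1; q; q^-1; x] ->
  sequenceable [:: p; p^-1; q; q^-1; x].
Proof.
set s := [:: p; p^-1; q; q^-1; x].
move=> us s1; apply/negPn/negP => bad.
have neq a b c d e : perm_eq [:: a; b; c; d; e] s -> a <> b.
  by move=> h E; move: us; rewrite -(perm_uniq h) E /= inE eqxx.
have n1 a b c d e : perm_eq [:: a; b; c; d; e] s -> a <> 1.
  by move=> h E; move: s1; rewrite -(perm_mem h) E inE eqxx.
(* In the order [x; p; q; p^-1; q^-1] only the commutator can be trivial. *)
have pq : p * q = q * p.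
  have h : perm_eq [:: x; p; q; p^-1; q^-1] s by clear; apply/permP => P /=; lia.
  case: (not_sequenceable5 _ _ _ _ _ _ bad s1 h) => [[]|||].
  - by move/mulg1_eq/(neq p^-1 q p q^-1 x); case; perm_from h.
  - by move/divg1_eq/(neq q p p^-1 q^-1 x); case; perm_from h.
  - by move/divg1_eq/(neq p^-1 q p q^-1 x); case; perm_from h.
  - move/divg1_eq; rewrite -{2}[p]mulg1 => /mulgI.
    by move/(n1 q p p^-1 q^-1 x); case; perm_from h.
  - move/divg1_eq; rewrite -{2}[q]mulg1 => /mulgI.
    by move/(n1 p^-1 p q q^-1 x); case; perm_from h.
  - by move/divg1_eq => E; rewrite -[LHS](mulgVK p) E.
(* In the order [[r; q; r'; q^-1; x]], commutation leaves [r' * q^-1 * x] as the only block that can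
   be trivial. *)
have key r r' : perm_eq [:: r; r'; q; q^-1; x] s -> r * r' = 1 -> q * r' = r' * q ->
    x = q * r.
  move=> h rr' qr'; have r'V : r'^-1 = r by apply/mulg1_eq/mulg1C.
  have h' : perm_eq [:: r; q; r'; q^-1; x] s by perm_from h.
  case: (not_sequenceable5 _ _ _ _ _ _ bad s1 h') => [[]|||].
  - move/mulg1C/mulg1_eq; rewrite r'V.
    by move/(neq r q r' q^-1 x); case; perm_from h.
  - by move/divg1_eq/(neq r' q r q^-1 x); case; perm_from h.
  - by move/mulg1_eq; rewrite invgK => /(neq q x r r' q^-1); case; perm_from h.
  - by rewrite qr' mulgK; move/(n1 r' r q q^-1 x); case; perm_from h.
  - by move/mulg1_eq; rewrite invgM invgK r'V.
  - rewrite qr' mulgK => /mulg1_eq; rewrite r'V.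
    by move/(neq r x r' q q^-1); case; perm_from h.
have ex : x = q * p.
  by apply: (key p p^-1) => //; [rewrite mulgV | exact/commuteV].
have : q * p = q * p^-1.
  rewrite -ex; apply: (key p^-1 p) => //; last by rewrite mulVg.
  by clear; apply/permP => P /=; lia.
by move/mulgI/(neq p p^-1 q q^-1 x); case.
Qed.

(** * Extracting inverse pairs, lists of at most four elements, and assembly *)

(** Involutions do not count as pairs: they are compatible with the second alternative. A further
    application to [t] looks for a second pair. *)
Lemma inverse_pair_dichotomy {G : groupType} (s : seq G) :
  (exists x t, perm_eq s [:: x, x^-1 & t]) \/ {in s &, forall x y, x * y = 1 -> x = y}.
Proof.
have [/hasP[x xs /andP[xV xx]]|noinv] := boolP (has (fun x => (x^-1 \in s) && (x^-1 != x)) s).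
  left; exists x, (rem x^-1 (rem x s)).
  rewrite (perm_trans (perm_to_rem xs)) // perm_cons; apply: perm_to_rem.
  by move: xV; rewrite (perm_mem (perm_to_rem xs)) inE (negPf xx).
right=> x y xs ys /mulg1_eq xy; apply/eqP.
by move: noinv => /hasPn/(_ x xs); rewrite xy ys eq_sym negbK.
Qed.

Lemma sequenceable_le4 {G : groupType} (s : seq G) :
  uniq s -> 1 \notin s -> size s <= 4 -> sequenceable s.
Proof.
move=> us s1 s4.
have sums2 (a b : G) : b != 1 -> uniq (partial_sums [:: a; b]).
  by move=> b1; rewrite uniq_partial_sums_cons /partial_sums /= mul1g inE eq_sym b1.
have sums3 (a b c : G) : b != 1 -> c != 1 -> b * c != 1 -> uniq (partial_sums [:: a; b; c]).
  move=> b1 c1 bc; rewrite uniq_partial_sums_cons sums2 //.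
  by rewrite /partial_sums /= mul1g !inE negb_or !(eq_sym 1) b1 bc.
have sums4 (a b c d : G) : b != 1 -> c != 1 -> d != 1 ->
    b * c != 1 -> c * d != 1 -> b * c * d != 1 -> uniq (partial_sums [:: a; b; c; d]).
  move=> b1 c1 d1 bc cd bcd; rewrite uniq_partial_sums_cons sums3 //.
  by rewrite /partial_sums /= mul1g !inE !negb_or !(eq_sym 1) b1 bc bcd.
case: (inverse_pair_dichotomy s) => [[p [t pt]]|noinv].
  apply: (@sequenceable_perm G [:: p, p^-1 & t]); first by rewrite perm_sym.
  move: us s1 s4; rewrite (perm_uniq pt) (perm_mem pt) (perm_size pt) => {s pt}.
  case: t => [|x [|y []]] //=; rewrite !inE !negb_or !(eq_sym 1) => us s1 _.
  - case/andP: s1 => p1 V1.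
    by apply/sequenceableP; exists [:: p; p^-1] => //; apply: sums2.
  - case/and3P: s1 us => p1 V1 x1 /and3P[/andP[pV px] _ _].
    apply/sequenceableP; exists [:: p; p^-1; x] => //; apply: sums3 => //.
    by apply: contraNneq px => /mulg1_eq; rewrite invgK => ->.
  - case/and4P: s1 us => p1 V1 x1 y1 /and4P[/and3P[pV px _] /andP[Vx _] _ _].
    (* The longest block avoiding [y] is a conjugate of [x], hence nontrivial. *)
    apply/sequenceableP; exists [:: y; p; x; p^-1].
      by clear; apply/permP => P /=; lia.
    apply: sums4 => //.
    + by apply: contraNneq Vx => /mulg1_eq ->.
    + by apply: contraNneq px => /divg1_eq ->.
    + by apply: contraNneq x1 => /divg1_eq; rewrite -{2}[p]mulg1 => /mulgI ->.
have mulN1 : {in s &, forall x y, x != y -> x * y != 1}.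
  by move=> x y xs ys; apply: contraNneq => /noinv ->.
move: us s1 mulN1; case: s s4 {noinv} => [|a [|b [|c [|d []]]]] //= _;
  rewrite ?inE ?negb_or ?(eq_sym 1) => us s1 mulN1; apply/sequenceableP.
- by exists [:: a; b] => //; apply: sums2; case/andP: s1.
- case/and3P: s1 us => _ b1 c1 /and3P[_ bc _].
  by exists [:: a; b; c] => //; apply: sums3 => //; apply: mulN1; rewrite // !inE eqxx ?orbT.
case/and4P: s1 us => a1 b1 c1 d1 /and4P[/and3P[ab ac _] /andP[bc _] cd _].
have {}mulN1 : [/\ a * c != 1, b * c != 1 & c * d != 1].
  by split; apply: mulN1; rewrite // !inE eqxx ?orbT.
(* If [b * c * d = 1], then [a * c * d] is nontrivial because [a] and [b] differ, so exchanging the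
   first two terms helps. *)
case: mulN1 => ac1 bc1 cd1; have [E|E] := eqVneq (b * c * d) 1.
  exists [:: b; a; c; d]; first by clear; apply/permP => P /=; lia.
  apply: sums4 => //; apply: contraNneq ab => F; apply/eqP.
  by apply: (mulIg c); apply: (mulIg d); rewrite E.
by exists [:: a; b; c; d] => //; apply: sums4.
Qed.

Lemma sequenceable5 {G : groupType} (s : seq G) :
  uniq s -> 1 \notin s -> size s = 5 -> sequenceable s.
Proof.
move=> us s1 s5; case: (inverse_pair_dichotomy s) => [[p [t pt]]|noinv]; last first.
  exact: sequenceable5_no_inverse.
apply: (@sequenceable_perm G [:: p, p^-1 & t]); first by rewrite perm_sym.
move: us s1 s5; rewrite (perm_uniq pt) (perm_mem pt) (perm_size pt) => {s pt} us s1 [t3].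
case: (inverse_pair_dichotomy t) => [[q [r qr]]|noinv].
  have perm_r : perm_eq [:: p, p^-1, q, q^-1 & r] [:: p, p^-1 & t].
    by rewrite !perm_cons perm_sym.
  apply: (sequenceable_perm _ _ perm_r).
  move: us s1 t3; rewrite -(perm_uniq perm_r) -(perm_mem perm_r) (perm_size qr).
  by case: r {qr perm_r} => [|x []] // us s1 _; apply: sequenceable5_two_inverses.
case: t t3 us s1 noinv => [|x [|y [|z []]]] // _ us s1 noinv.
have /and4P[_ _ /= ] := us; rewrite !inE !negb_or => /andP[/eqP xy /eqP xz] /andP[/eqP yz _].
by apply: sequenceable5_one_inverse; rewrite ?mulgV // => /noinv E;
  [apply: xy | apply: xz | apply: yz]; apply: E; rewrite !inE eqxx ?orbT.
Qed.

Theorem theorem5p1 (G : groupType) (A : {fset G}) :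
  1%g \notin A -> #|` A| <= 5 ->
  exists s : seq G, [/\ uniq s, s =i A & uniq (partial_sums s)].
Proof.
move=> A1 A5; have /sequenceableP[s sA su] : sequenceable (enum_fset A).
  move: A5; rewrite leq_eqVlt => /orP[/eqP A5|A4].
    exact: sequenceable5 (fset_uniq A) A1 A5.
  exact: sequenceable_le4 (fset_uniq A) A1 A4.
by exists s; split; [rewrite (perm_uniq sA) fset_uniq | apply: perm_mem sA | ].
Qed.
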